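(* Let $Y=(Y_n)_{n\in\mathbb{N}_0}$ be a combinatorial Markov chain on $\mathbb{F}$ with distribution $\mathbb{P}$, and let $\bar{\mathbb{F}}$ and $\partial\mathbb{F}$ be the associated Doob-Martin compactification and Martin boundary. Then, in $\bar{\mathbb{F}}$, $Y_n$ converges $\mathbb{P}$-almost surely as $n\to\infty$ to some random variable $Y_\infty$ with values in $\partial\mathbb{F}$.
   Context: Combinatorial Markov chain (CMC): $\mathbb{F}=\bigcup_{n=0}^\infty\mathbb{F}_n$ is a disjoint union of finite sets $\mathbb{F}_n$ (the objects of size $n$), with $\mathbb{F}_0=\{e\}$ a singleton. A CMC on $\mathbb{F}$ is a Markov chain $Y=(Y_n)_{n\in\mathbb{N}_0}$ with $\mathbb{P}(Y_n\in\mathbb{F}_n)=1$ for all $n\in\mathbb{N}_0$, $Y_0\equiv e$, which is weakly irreducible: $\mathbb{P}(Y_n=x)>0$ for all $n$ and all $x\in\mathbb{F}_n$. The chain is taken in canonical form: the underlying space is the path space $\mathbb{F}_\infty=\prod_{n=0}^\infty\mathbb{F}_n$, $Y_n$ is the projection to the $n$th coordinate, the $\sigma$-field is $\mathcal{B}_\infty=\sigma(Y_n:n\in\mathbb{N}_0)$, and $\mathbb{P}$ is a probability measure on $(\mathbb{F}_\infty,\mathcal{B}_\infty)$. Martin kernel: for $m\le n$, $x\in\mathbb{F}_m$, $y\in\mathbb{F}_n$, $$K(x,y)=\frac{\mathbb{P}(Y_n=y\mid Y_m=x)}{\mathbb{P}(Y_n=y)}\in\Bigl[0,\frac{1}{\mathbb{P}(Y_m=x)}\Bigr],$$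 and $K(x,y)=0$ if the size of $x$ exceeds the size of $y$. Compactification: give $\mathbb{F}$ the discrete topology. The map $y\mapsto (x\mapsto K(x,y))$ embeds $\mathbb{F}$ into the compact product space $\prod_{m=1}^\infty\prod_{x\in\mathbb{F}_m}[0,1/\mathbb{P}(Y_m=x)]$, and $\mathbb{F}$ is identified with its image. The Doob-Martin compactification $\bar{\mathbb{F}}$ is the closure of $\mathbb{F}$ in this space, and the Martin boundary is $\partial\mathbb{F}=\bar{\mathbb{F}}\setminus\mathbb{F}$, with its Borel $\sigma$-field. *)

(* Defs.v *)
From HB Require Import structures.
From mathcomp Require Import all_boot all_order all_algebra.
From mathcomp Require Import all_classical all_reals all_analysis.

Set Implicit Arguments.
Unset Strict Implicit.
Unset Printing Implicit Defensive.

Import Order.TTheory GRing.Theory Num.Theory.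
Import numFieldNormedType.Exports.

Local Open Scope classical_set_scope.
Local Open Scope ring_scope.

(* [obj C n] is the finite set F_n of objects of size n.  Nonemptiness of F_n
   is implied by P(Y_n \in F_n) = 1; it is recorded here only because
   measurable types have to be pointed. *)
Record combClass := CombClass {
  obj :> nat -> finType;
  card_obj0 : #|obj 0| = 1%N;
  card_obj_gt0 : forall n, (0 < #|obj n|)%N }.

(* The disjoint union F of the F_n, and its elements of positive size (the
   index set of the product in which F is embedded).  The size of
   [x : objects C] is [tag x]. *)
Definition objects (C : combClass) := {n : nat & C n}.
Definition pos_objects (C : combClass) := {m : nat & C m.+1}.

Definition pos_object (C : combClass) (x : pos_objects C) : objects C :=
  Tagged (obj C) (tagged x).

Definition paths (C : combClass) := forall n, C n.

HB.instance Definition _ (C : combClass) := Choice.on (paths C).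
HB.instance Definition _ (C : combClass) := isPointed.Build (paths C)
  (fun n => enum_val (Ordinal (card_obj_gt0 C n))).

(* The chain in canonical form: Y_n is the n-th coordinate projection. *)
Definition Y (C : combClass) (n : nat) (w : paths C) : C n := w n.

Definition coordinate_events (C : combClass) : set (set (paths C)) :=
  \bigcup_n preimage_set_system setT (@Y C n) [set: set (C n)].

(* The path space with the sigma-field sigma(Y_n : n). *)
Definition path_space (C : combClass) :=
  g_sigma_algebraType (@coordinate_events C).
HB.instance Definition _ (C : combClass) := Measurable.on (path_space C).

Section Chain.
Context {R : realType} {C : combClass}.
Variable P : probability (path_space C) R.

Definition Pr (A : set (path_space C)) : R := fine (P A).

(* Total: equal to 0 when P(B) = 0. *)
Definition cond_Pr (A B : set (path_space C)) : R := Pr (A `&` B) / Pr B.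

(* {Y_n = x}, where n is the size of x. *)
Definition visits (x : objects C) : set (path_space C) :=
  [set w | Y (tag x) w = tagged x].

(* {Y_0 = v_0, ..., Y_n = v_n} *)
Definition history (n : nat) (v : paths C) : set (path_space C) :=
  [set w | forall k, (k <= n)%N -> Y k w = v k].

Definition markov_property : Prop :=
  forall (n : nat) (v : paths C) (y : C n.+1),
    0 < Pr (history n v) ->
    cond_Pr [set w | Y n.+1 w = y] (history n v) =
    cond_Pr [set w | Y n.+1 w = y] [set w | Y n w = v n].

Definition weakly_irreducible : Prop :=
  forall (n : nat) (x : C n), 0 < Pr [set w | Y n w = x].

(* Y_n \in F_n and Y_0 = e hold by typing, F_0 being a singleton. *)
Definition is_CMC : Prop := markov_property /\ weakly_irreducible.

Definition martin_kernel (x y : objects C) : R :=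
  if (tag x <= tag y)%N
  then cond_Pr (visits y) (visits x) / Pr (visits y) else 0.

Lemma measurable_visits (x : objects C) : measurable (visits x).
Proof.
apply: sub_sigma_algebra; exists (tag x) => //.
by exists [set tagged x] => //; rewrite setTI.
Qed.

Lemma Pr_ge0 (A : set (path_space C)) : 0 <= Pr A.
Proof. by rewrite /Pr fine_ge0. Qed.

Definition kernel_range (x : objects C) : set R :=
  `[0, (Pr (visits x))^-1].

Lemma martin_kernel_range (x y : objects C) :
  kernel_range x (martin_kernel x y).
Proof.
rewrite /kernel_range /= in_itv /= /martin_kernel; case: ifP => _; last first.
  by rewrite lexx invr_ge0 Pr_ge0.
have mvx := measurable_visits x; have mvy := measurable_visits y.
rewrite /cond_Pr; apply/andP; split.
  by rewrite !mulr_ge0 ?invr_ge0 ?Pr_ge0.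
rewrite mulrAC ler_piMl ?invr_ge0 ?Pr_ge0//.
have [Py0|Py_neq0] := eqVneq (Pr (visits y)) 0.
  by rewrite Py0 invr0 mulr0 ler01.
rewrite ler_pdivrMr ?lt_neqAle ?Pr_ge0 1?eq_sym ?Py_neq0// mul1r.
rewrite /Pr fine_le ?fin_num_measure//; first exact: measurableI.
by rewrite le_measure ?inE//; exact: measurableI.
Qed.

(* The compact product of the intervals [0, 1/P(Y_m = x)] over m >= 1 and
   x \in F_m, with the product topology. *)
Definition martin_product : topologicalType :=
  prod_topology (fun x : pos_objects C => set_type (kernel_range (pos_object x))).

Definition martin_map (y : objects C) : martin_product :=
  fun x => exist (fun k => k \in kernel_range (pos_object x)) _
    (mem_set (martin_kernel_range (pos_object x) y)).

(* The closure of the image of F, with the subspace topology. *)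
Definition doob_martin : topologicalType :=
  set_type (closure (range martin_map)).

Definition in_doob_martin (y : objects C) : doob_martin :=
  exist (fun z => z \in closure (range martin_map)) _
    (mem_set (subset_closure (imageT martin_map y))).

(* [in_doob_martin] identifies F with its image. *)
Definition martin_boundary : topologicalType :=
  set_type (~` range in_doob_martin).

Definition in_compactification (z : martin_boundary) : doob_martin := set_val z.

(* Measurability with respect to the Borel sigma-field of the boundary.  It is
   spelled out because [measurable_fun] would require [martin_boundary] to be
   pointed. *)
Definition boundary_rv (Z : path_space C -> martin_boundary) : Prop :=
  forall B : set martin_boundary, <<s open >> B -> measurable (Z @^-1` B).

End Chain.

(* Main.v *)
Require Import Defs.
From mathcomp Require Import all_boot all_order all_algebra.
From mathcomp Require Import all_classical all_reals all_analysis.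
From mathcomp Require Import measurable_realfun ring.
Import Order.TTheory GRing.Theory Num.Theory.
Import numFieldNormedType.Exports.
Local Open Scope classical_set_scope.
Local Open Scope ring_scope.

(** Fix an object x of size m.  By the Markov property, for n >= m the value
    K(x, Y_n) equals P(Y_m = x | Y_n, ..., Y_N) / P(Y_m = x) for every horizon
    N >= n, so (K(x, Y_n))_{n >= m} is a bounded martingale for the decreasing
    filtration generated by (Y_n, Y_{n+1}, ...); this is [reverse_martingale].
    Its increments are orthogonal, hence its second moment v_n is nonincreasing
    and E (K(x, Y_k) - K(x, Y_N))^2 = v_k - v_N ([variance_increment]).
    Kolmogorov's inequality, run backwards from the horizon N, upgrades this to
    eps^2 P(|K(x, Y_n) - K(x, Y_N)| >= eps for some n in [k, N]) <= v_k - v_N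
    ([maximal_inequality]).  As v_n converges, the right-hand side is small
    for k large, uniformly in N, so K(x, Y_n) is almost surely Cauchy
    ([kernel_along_cvg]).  For a fixed horizon N only the finitely many prefixes
    of length N + 1 matter, so all expectations are finite sums.

    There are countably many x, so almost surely K(x, Y_n) converges for all x
    at once, that is, Y_n converges in the product space, to a point z of the
    closure of F.  This z is not an object: sum_{x in F_m} P(Y_m = x) K(x, y)
    equals 1 as soon as y has size at least m, so the same sum with z(x) in
    place of K(x, y) is 1 for every m >= 1, whereas for an object y it vanishes
    once m exceeds the size of y ([boundary_limit]).

    For measurability, the limit has measurable coordinates, as pointwise limits
    of measurable functions.  This suffices for the Borel sigma-field because
    each open set pulls back to a countable union of boxes centred at objects,
    objects being countable and dense in the compactification
    ([boundary_rv_coordinates]). *)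

Section MartinLimit.
Set Implicit Arguments.
Unset Strict Implicit.
Unset Printing Implicit Defensive.

(** * Convergence in subspaces and products *)

Lemma cvg_set_type (X : topologicalType) (A : set X)
    (F : set_system (set_type A)) (FF : Filter F) (z : set_type A) :
  set_val x @[x --> F] --> set_val z -> F --> z.
Proof.
move=> h U [V [[W oW <-] Wz] sVU].
exact: (filterS sVU (h W (open_nbhs_nbhs (conj oW Wz)))).
Qed.

Lemma cvg_prod_topology (I : Type) (T : I -> topologicalType)
    (F : set_system (prod_topology T)) (FF : Filter F) (z : prod_topology T) :
  (forall i, f i @[f --> F] --> z i) -> F --> z.
Proof.
move=> h; apply: (proj2 (@cvg_sup _ _ _ F z FF)) => i U [V [[W oW <-] Wz] sVU].
exact: (filterS sVU (h i W (open_nbhs_nbhs (conj oW Wz)))).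
Qed.

(** * Events and functions of finitely many coordinates *)

Section FiniteDimensional.
Context {C : combClass}.

Definition prefix N := {dffun forall i : 'I_N.+1, C i}.
Definition restrict N (w : paths C) : prefix N := [ffun i : 'I_N.+1 => w i].

(** Completion of a prefix to a path; the coordinates beyond [N] are arbitrary. *)
Definition extend N (u : prefix N) : paths C := fun k =>
  match @idP (k < N.+1)%N with
  | ReflectT lt_kN => u (Ordinal lt_kN)
  | ReflectF _ => @point (paths C) k
  end.

Definition agree N (w w' : paths C) := forall k, (k <= N)%N -> w k = w' k.
Definition determined_by N (T : Type) (f : paths C -> T) :=
  forall w w', agree N w w' -> f w = f w'.

Lemma extend_restrict N w : agree N (extend (restrict N w)) w.
Proof.
move=> k kN; rewrite /extend; case: {-}_ / idP => [h|/(_ kN)//].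
by rewrite ffunE.
Qed.

Lemma restrict_eq N w w' : (restrict N w = restrict N w') <-> agree N w w'.
Proof.
split=> [e k kN|e]; first by rewrite -(extend_restrict w kN) e extend_restrict.
by apply/ffunP => i; rewrite !ffunE e// -ltnS.
Qed.

Lemma restrict_extend N (u : prefix N) : restrict N (extend u) = u.
Proof.
apply/ffunP => -[i lt_iN]; rewrite ffunE /extend /=; case: {-}_ / idP => // h.
by rewrite (bool_irrelevance h lt_iN).
Qed.

Context {R : realType} (P : probability (path_space C) R).
Local Notation Pr := (Pr P).

Lemma Pr_partition (T : finType) (H : T -> set (path_space C))
    (D : set (path_space C)) :
  measurable D -> (forall t, measurable (H t)) ->
  (forall w, D w -> exists t, H t w) ->
  (forall t t' w, H t w -> H t' w -> t = t') ->
  Pr D = \sum_t Pr (D `&` H t).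
Proof.
move=> mD mH cov dis.
have DE : D = \bigcup_(t in [set: T]) (D `&` H t).
  apply/seteqP; split => [w Dw|w [t _ []//]].
  by have [t Ht] := cov _ Dw; exists t.
rewrite /Defs.Pr {1}DE measure_fin_bigcup; last 3 first.
- exact: finite_finset.
- apply/trivIsetP => i j _ _ /eqP ij; apply/seteqP; split => // w [[_ Hi] [_ Hj]].
  exact: ij (dis _ _ _ Hi Hj).
- by move=> t _; exact: measurableI.
have -> : [set: T] = [set` enum T].
  by apply/seteqP; split => t //= _; rewrite mem_enum.
rewrite -fsbig_seq ?enum_uniq// big_enum /= -sum_fine// => t _.
by rewrite fin_num_measure//; exact: measurableI.
Qed.

Lemma measurable_coord n (S : set (C n)) :
  measurable [set w : path_space C | S (w n)].
Proof.
by apply: sub_sigma_algebra; exists n => //; exists S => //; rewrite setTI.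
Qed.

Lemma measurable_history N v : measurable (history N v : set (path_space C)).
Proof.
rewrite (_ : history N v = \bigcap_(k in `I_N.+1) [set w | [set v k] (w k)]).
  by apply: bigcap_measurable => [|k _]; [exists 0%N|exact: measurable_coord].
by apply/seteqP; split => w h k /=; [rewrite ltnS; exact: h|move=> kN; exact: h].
Qed.

Lemma measurable_determined N (D : set (path_space C)) :
  determined_by N D -> measurable D.
Proof.
move=> dD.
rewrite (_ : D = \bigcup_(u in [set u : prefix N | D (extend u)])
                   history N (extend u)).
  apply: fin_bigcup_measurable => [|u _]; first exact: finite_finset.
  exact: measurable_history.
apply/seteqP; split => [w Dw|w [u Du hw]]; last by rewrite (dD _ (extend u)).
exists (restrict N w) => [/=|k kN]; last by rewrite extend_restrict.
by rewrite (dD _ w)//; exact: extend_restrict.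
Qed.

Lemma Pr_history_partition N (D : set (path_space C)) : measurable D ->
  Pr D = \sum_(u : prefix N) Pr (D `&` history N (extend u)).
Proof.
move=> mD; apply: Pr_partition => // [u|w _|u u' w Hu Hu'].
- exact: measurable_history.
- by exists (restrict N w) => k kN; rewrite extend_restrict.
- rewrite -(restrict_extend u) -(restrict_extend u').
  by apply/restrict_eq => k kN; rewrite -Hu// -Hu'.
Qed.

(** The expectation of a function of [Y_0, ..., Y_N], as a finite sum over the
    atoms of the sigma-field that these coordinates generate. *)
Definition expect N (f : paths C -> R) : R :=
  \sum_(u : prefix N) Pr (history N (extend u)) * f (extend u).

Lemma expectD N f g : expect N (fun w => f w + g w) = expect N f + expect N g.
Proof. by rewrite -big_split; apply: eq_bigr => u _; rewrite mulrDr. Qed.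

Lemma expectZ N c f : expect N (fun w => c * f w) = c * expect N f.
Proof. by rewrite mulr_sumr; apply: eq_bigr => u _; rewrite mulrCA. Qed.

Lemma expect_le N f g : (forall w, f w <= g w) -> expect N f <= expect N g.
Proof. by move=> fg; apply: ler_sum => u _; rewrite ler_wpM2l// Pr_ge0. Qed.

Lemma expect_ge0 N f : (forall w, 0 <= f w) -> 0 <= expect N f.
Proof. by move=> f0; apply: sumr_ge0 => u _; rewrite mulr_ge0// Pr_ge0. Qed.

Lemma eq_expect N f g : f =1 g -> expect N f = expect N g.
Proof. by move=> fg; apply: eq_bigr => u _; rewrite fg. Qed.

Lemma expect_indic N (D : set (path_space C)) :
  determined_by N D -> expect N \1_D = Pr D.
Proof.
move=> dD; rewrite (Pr_history_partition N (measurable_determined dD)).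
apply: eq_bigr => u _; rewrite indicE; case: (boolP (_ \in _)) => /= [|/negP] Du.
  rewrite mulr1; congr Pr; apply/esym/setIidr => w hw.
  by rewrite (dD _ (extend u))//; exact/set_mem.
rewrite mulr0 (_ : _ `&` _ = set0) ?/Defs.Pr ?measure0//.
apply/seteqP; split => // w [Dw hw]; apply: Du; apply/mem_set.
by rewrite -(dD w).
Qed.

Definition window n N (v : paths C) : set (paths C) :=
  [set w | forall k, (n <= k <= N)%N -> w k = v k].

(** Measurability with respect to [Y_n, ..., Y_N], the stages of the decreasing
    filtration truncated at the horizon [N]. *)
Definition window_determined n N (T : Type) (f : paths C -> T) :=
  forall w w', window n N w w' -> f w = f w'.

(** Erasing the coordinates before [n] singles out one representative in each
    class of paths with the same coordinates in a window starting at [n]. *)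
Definition forget n (w : paths C) : paths C :=
  fun k => if (n <= k)%N then w k else @point (paths C) k.

(** A function of [Y_n, ..., Y_N] is a combination of indicators of windows; the
    filter keeps one prefix for each window, so that no window is counted
    twice. *)
Lemma window_determined_sum n N (f : paths C -> R) : window_determined n N f ->
  f =1 (fun w => \sum_(u : prefix N | restrict N (forget n (extend u)) == u)
                   f (extend u) * \1_(window n N (extend u)) w).
Proof.
move=> df w.
have ef k : (n <= k <= N)%N -> extend (restrict N (forget n w)) k = w k.
  by case/andP => nk kN; rewrite extend_restrict// /forget nk.
rewrite (bigD1 (restrict N (forget n w)))/=; last first.
  apply/eqP/restrict_eq => k kN; rewrite /forget; case: ifP => // nk.
  by rewrite extend_restrict// nk.
rewrite big1 ?addr0.
  rewrite indicE mem_set ?mulr1; last by move=> k kN; rewrite ef.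
  by apply: df => k kN; rewrite ef.
move=> u /andP[/eqP uE /eqP ne]; rewrite indicE.
case: (boolP (_ \in _)); rewrite ?mulr0// => /set_mem hw; case: ne.
rewrite -uE; apply/restrict_eq => k kN; rewrite /forget; case: ifP => // nk.
by rewrite hw// nk.
Qed.

Lemma window_determined_by n N (T : Type) (f : paths C -> T) :
  window_determined n N f -> determined_by N f.
Proof. by move=> h w w' ww'; apply: h => k /andP[_ kN]; rewrite ww'. Qed.

Lemma window_determinedW n n' N N' (T : Type) (f : paths C -> T) :
  (n' <= n)%N -> (N <= N')%N ->
  window_determined n N f -> window_determined n' N' f.
Proof.
move=> nn NN h w w' ww'; apply: h => k /andP[nk kN]; apply: ww'.
by rewrite (leq_trans nn nk) (leq_trans kN NN).
Qed.

Lemma window_determined_window n N v :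
  window_determined n N (window n N v).
Proof.
move=> w w' ww'; apply/propext; split => h k kn; first by rewrite ww'// h.
by rewrite -ww'// h.
Qed.

(** The finite sums for different horizons are consistent. *)
Lemma expect_widen n N f :
  (n <= N)%N -> determined_by n f -> expect N f = expect n f.
Proof.
move=> nN df; have tf : window_determined 0 n f.
  by move=> w w' h; apply: df => k kn; rewrite h.
suff expectE M : (n <= M)%N -> expect M f =
    \sum_(u : prefix n | restrict n (forget 0 (extend u)) == u)
      f (extend u) * Pr (window 0 n (extend u)).
  by rewrite !expectE.
move=> nM; rewrite (eq_expect M (window_determined_sum tf)) /expect.
under eq_bigr do rewrite mulr_sumr.
rewrite exchange_big; apply: eq_bigr => u _.
rewrite -(@expect_indic M).
  by rewrite /expect mulr_sumr; apply: eq_bigr => u' _; rewrite mulrCA.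
apply: (@window_determined_by 0).
exact: (window_determinedW (leqnn 0) nM (window_determined_window _)).
Qed.

Lemma Pr_le (A B : set (path_space C)) :
  measurable A -> measurable B -> A `<=` B -> Pr A <= Pr B.
Proof.
by move=> mA mB AB; rewrite fine_le ?fin_num_measure// le_measure ?inE.
Qed.

(** * The Markov property on windows *)

Definition transition n (a : C n) (b : C n.+1) : R :=
  cond_Pr P [set w | Y n.+1 w = b] [set w | Y n w = a].

(** The Markov property is given for complete histories; summing over the
    histories that make up [E] extends it to every past event [E]. *)
Lemma markov_event (HP : markov_property P) n (E : set (path_space C))
    (a : C n) (b : C n.+1) :
  determined_by n E -> (forall w, E w -> Y n w = a) ->
  Pr (E `&` [set w | Y n.+1 w = b]) = Pr E * transition a b.
Proof.
move=> dE Ea; have mE := measurable_determined dE.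
have mb : measurable [set w : path_space C | Y n.+1 w = b].
  exact: (measurable_coord [set b]).
rewrite (@Pr_history_partition n); last exact: measurableI.
rewrite (@Pr_history_partition n E)// mulr_suml; apply: eq_bigr => u _.
have mh := measurable_history n (extend u).
have [Eu|nEu] := pselect (E (extend u)); last first.
  have H0 (A : set (path_space C)) : A `<=` E -> A `&` history n (extend u) = set0.
    move=> AE; apply/seteqP; split => // w [/AE Ew hw]; apply: nEu.
    by rewrite -(dE w).
  by rewrite !H0// /Defs.Pr measure0 mul0r.
have HE : history n (extend u) `<=` E.
  by move=> w hw; rewrite (dE _ (extend u)).
rewrite setIAC (setIidr HE) setIC.
(* Histories of probability 0, on which the Markov property says nothing. *)
have [h0|hn0] := eqVneq (Pr (history n (extend u))) 0.
  rewrite h0 mul0r; apply/eqP; rewrite eq_le Pr_ge0 andbT -h0.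
  by apply: Pr_le => //; exact: measurableI.
have := HP n (extend u) b; rewrite lt_neqAle eq_sym hn0 Pr_ge0 => /(_ isT).
rewrite {1}/cond_Pr => /(canRL (divfK hn0)) ->.
by rewrite mulrC /transition -(Ea _ Eu).
Qed.

(** The factor contributed by the window depends on the past event [E] only
    through its final value [v n], so it cancels when two such events are
    compared. *)
Lemma markov_window (HP : markov_property P) n N (E : set (path_space C))
    (v : paths C) :
  (n <= N)%N -> determined_by n E -> (forall w, E w -> Y n w = v n) ->
  Pr (E `&` window n N v) = Pr E * \prod_(n <= k < N) transition (v k) (v k.+1).
Proof.
move=> nN dE Ev; rewrite -(subnKC nN); elim: (N - n)%N => [|d IH].
  rewrite addn0 big_geq// mulr1; congr Pr; apply/setIidl => w Ew k.
  by rewrite -eqn_leq => /eqP <-; exact: Ev.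
rewrite addnS big_nat_recr ?leq_addr//= mulrA -IH -markov_event//.
- congr Pr; apply/seteqP; split => [w [Ew tw]|w [[Ew tw] vw]].
    split; last by apply: tw; rewrite leqnn (leq_trans (leq_addr d n)).
    by split => // k /andP[nk kd]; apply: tw; rewrite nk (leq_trans kd).
  split => // k /andP[nk]; rewrite leq_eqVlt => /orP[/eqP ->//|kd].
  by apply: tw; rewrite nk.
- move=> w w' ww'; congr (_ /\ _).
    by apply: dE => k kn; apply: ww'; rewrite (leq_trans kn)// leq_addr.
  by apply: (window_determined_by (@window_determined_window n (n + d) v)).
- by move=> w [Ew]; apply; rewrite leqnn leq_addr.
Qed.

End FiniteDimensional.

(** * The kernel along the chain is a reversed martingale *)

Section ReverseMartingale.
Context {R : realType} {C : combClass} (P : probability (path_space C) R).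
Context (HP : is_CMC P).
Local Notation Pr := (Pr P).
Local Notation expect := (expect P).

Let markovP : markov_property P. Proof. by case: HP. Qed.

Lemma visits_gt0 (x : objects C) : 0 < Pr (visits x).
Proof. by case: HP => _ /(_ (tag x) (tagged x)). Qed.

Context (x : objects C).

Definition kernel_along n (w : paths C) : R :=
  martin_kernel P x (Tagged (obj C) (Y n w)).
Local Notation X := kernel_along.

Lemma martin_kernelE (y : objects C) : (tag x <= tag y)%N ->
  Pr (visits x `&` visits y) = Pr (visits x) * martin_kernel P x y * Pr (visits y).
Proof.
move=> xy; rewrite /martin_kernel xy /cond_Pr setIC.
have := visits_gt0 x; have := visits_gt0 y => /lt0r_neq0 py /lt0r_neq0 px.
by rewrite mulrA divfK// mulrCA divff// mulr1.
Qed.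

Lemma visits_determined n (y : objects C) :
  (tag y <= n)%N -> determined_by n (visits y).
Proof. by move=> yn w w' ww'; rewrite /visits /= /Y ww'. Qed.

Lemma kernel_along_determined n w w' : w n = w' n -> X n w = X n w'.
Proof. by rewrite /kernel_along /Y => ->. Qed.

(** Given [Y_n = v_n], the rest of the window carries no further information on
    whether [x] was visited. *)
Lemma Pr_visits_window n N v : (tag x <= n <= N)%N ->
  Pr (visits x `&` window n N v) = Pr (visits x) * X n v * Pr (window n N v).
Proof.
case/andP => xn nN; pose y : objects C := Tagged (obj C) (v n).
have dy : determined_by n (visits y) by exact: visits_determined.
have tE : visits y `&` window n N v = window n N v.
  by apply/setIidr => w; apply; rewrite leqnn.
rewrite -tE setIA (markov_window markovP)//; last 2 first.
- move=> w w' ww'; congr (_ /\ _); last exact: dy.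
  exact: (visits_determined xn).
- by move=> w [].
by rewrite (markov_window markovP)// martin_kernelE// mulrA.
Qed.

(** The defining property of [X n] as a version of
    [P(visits x | Y_n, ..., Y_N) / P(visits x)]. *)
Lemma reverse_martingale n N g : (tag x <= n <= N)%N -> window_determined n N g ->
  expect N (fun w => g w * \1_(visits x) w) =
  Pr (visits x) * expect N (fun w => g w * X n w).
Proof.
move=> xnN dg; have /andP[xn nN] := xnN.
(* By linearity, [g] may be taken to be the indicator of a window. *)
have gE f : (fun w => g w * f w) =1
    (fun w => \sum_(u : prefix N | restrict N (forget n (extend u)) == u)
      g (extend u) * (\1_(window n N (extend u)) w * f w)).
  move=> w; rewrite (window_determined_sum dg) mulr_suml.
  by apply: eq_bigr => u _; rewrite mulrA.
rewrite !(eq_expect _ _ (gE _)) /expect.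
under eq_bigr do rewrite mulr_sumr.
under [in RHS]eq_bigr do rewrite mulr_sumr.
rewrite exchange_big [in RHS]exchange_big mulr_sumr; apply: eq_bigr => u _.
have dW := window_determined_by (@window_determined_window _ n N (extend u)).
transitivity (g (extend u) * Pr (visits x `&` window n N (extend u))).
  rewrite -(@expect_indic _ _ _ N).
    rewrite /expect mulr_sumr; apply: eq_bigr => u' _.
    by rewrite indicI mulrCA /= (mulrC (\1_(visits x) _)).
  move=> w w' ww'; congr (_ /\ _); last exact: dW.
  exact: (visits_determined (leq_trans xn nN)).
rewrite Pr_visits_window// -(@expect_indic _ _ _ N _ dW).
rewrite /expect !mulr_sumr; apply: eq_bigr => u' _.
rewrite indicE; case: (boolP (_ \in _)) => [/set_mem h|]; last first.
  by rewrite !(mulr0,mul0r).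
rewrite (kernel_along_determined (h n _)) ?leqnn//=.
by rewrite !mulr1 mul1r; ring.
Qed.

Lemma reverse_martingale_step k n N g :
  (tag x <= k <= n)%N -> (n <= N)%N -> window_determined n N g ->
  expect N (fun w => g w * X n w) = expect N (fun w => g w * X k w).
Proof.
case/andP=> xk kn nN dg.
apply: (mulfI (lt0r_neq0 (visits_gt0 x))).
rewrite -!reverse_martingale//.
- by rewrite xk (leq_trans kn).
- exact: (window_determinedW kn (leqnn N) dg).
- by rewrite (leq_trans xk kn).
Qed.

Lemma kernel_along_window n N k :
  (n <= k <= N)%N -> window_determined n N (X k).
Proof.
by move=> kn w w' ww'; apply: kernel_along_determined; exact/esym/ww'.
Qed.

(** Backward increments over [k, n] and [n, N] are orthogonal, even after
    weighting by a function of [Y_n, ..., Y_N]; so extending the range to [k]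
    only increases the weighted mean square. *)
Lemma reverse_increment k n N g :
  (tag x <= k <= n)%N -> (n <= N)%N -> window_determined n N g ->
  (forall w, 0 <= g w) ->
  expect N (fun w => g w * (X n w - X N w) ^+ 2) <=
  expect N (fun w => g w * (X k w - X N w) ^+ 2).
Proof.
move=> xkn nN dg g0.
have dh : window_determined n N (fun w => g w * (X n w - X N w)).
  move=> w w' ww'; congr (_ * (_ - _)); first exact: dg.
    by apply: (@kernel_along_window n N) => //; rewrite leqnn.
  by apply: (@kernel_along_window n N) => //; rewrite leqnn andbT.
have cross := reverse_martingale_step xkn nN dh.
have -> : expect N (fun w => g w * (X k w - X N w) ^+ 2) =
   expect N (fun w => g w * (X n w - X N w) ^+ 2) +
   (expect N (fun w => g w * (X k w - X n w) ^+ 2) +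
    (2 * expect N (fun w => g w * (X n w - X N w) * X k w) +
    (-2) * expect N (fun w => g w * (X n w - X N w) * X n w))).
  by rewrite -!expectZ -!expectD; apply: eq_expect => w; ring.
rewrite cross -mulrDl subrr mul0r addr0 lerDl.
by apply: expect_ge0 => w; rewrite mulr_ge0// sqr_ge0.
Qed.

Definition second_moment n := expect n (fun w => X n w ^+ 2).

(** Testing the martingale property against [X N] itself gives
    [E (X N * X k) = E (X N ^+ 2)]. *)
Lemma variance_increment k N : (tag x <= k <= N)%N ->
  expect N (fun w => (X k w - X N w) ^+ 2) = second_moment k - second_moment N.
Proof.
move=> xkN; have /andP[xk kN] := xkN.
have cross := reverse_martingale_step xkN (leqnn N) (@kernel_along_window N N N _).
rewrite leqnn in cross; move/(_ isT) in cross.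
rewrite /second_moment -(@expect_widen _ _ _ k N) //; last first.
  by move=> w w' ww'; rewrite (kernel_along_determined (ww' k _)).
have -> : expect N (fun w => X N w ^+ 2) =
    2 * expect N (fun w => X N w * X k w) - expect N (fun w => X N w ^+ 2).
  rewrite -cross mulr2n mulrDl mul1r addrK; exact: eq_expect.
rewrite -[- (_ - _)]mulN1r mulrBr mulN1r mulN1r opprK -mulN1r -!expectZ -!expectD.
by apply: eq_expect => w; ring.
Qed.

(** * The maximal inequality *)

Definition strays (eps : R) k N : set (paths C) :=
  [set w | exists2 n, (k <= n <= N)%N & eps <= `|X n w - X N w| ].

(** Kolmogorov's inequality, by downward induction on [k].  The stronger claim
    [eps ^+ 2 * P(strays) <= E (\1_strays * (X k - X N) ^+ 2)] is inherited:
    paths that stray in [k + 1, N] are handled by [reverse_increment], and those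
    that stray at time [k] but not later satisfy it pointwise. *)
Lemma maximal_inequality eps k N : 0 < eps -> (tag x <= k <= N)%N ->
  eps ^+ 2 * Pr (strays eps k N) <= second_moment k - second_moment N.
Proof.
move=> e0 xkN; have /andP[xk kN] := xkN.
have tB j : window_determined j N (strays eps j N).
  move=> w w' ww'; apply/propext; split => -[n jn en]; exists n => //; move: en;
    have /andP[jn' nN] := jn;
    by rewrite (kernel_along_window jn ww') (@kernel_along_window j N N _ _ _ ww')//
               leqnn (leq_trans jn').
pose S j : paths C -> R := \1_(strays eps j N).
rewrite -variance_increment// -(@expect_indic _ _ _ N _ (window_determined_by (tB k))).
rewrite -expectZ -[\1_(strays eps k N)]/(S k).
apply: (@le_trans _ _ (expect N (fun w => S k w * (X k w - X N w) ^+ 2))); last first.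
  apply: expect_le => w; rewrite ler_piMl ?sqr_ge0// /S indicE.
  by case: (_ \in _).
have ge_sqr w j : eps <= `|X j w - X N w| -> eps ^+ 2 <= (X j w - X N w) ^+ 2.
  by move=> h; rewrite -[leRHS]real_normK ?num_real// lerXn2r ?nnegrE// ltW.
move: xk; rewrite -(subKn kN); have : (N - k <= N)%N by rewrite leq_subr.
elim: (N - k)%N => [_ _|d IH dN xk].
  rewrite subn0; apply: expect_le => w; rewrite /S indicE [leLHS]mulrC.
  case: (boolP (_ \in _)); last by rewrite !mul0r.
  rewrite !mul1r => /set_mem[n /= nN /ge_sqr].
  by move: nN; rewrite -eqn_leq => /eqP <-; apply.
set k' := (N - d.+1)%N in xk *.
have k'S : (N - d)%N = k'.+1 by rewrite /k' -subSn// subSS.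
move: IH; rewrite k'S => /(_ (ltnW dN)) IH.
have {}IH := IH (leqW xk).
have IH2 := le_trans IH (@reverse_increment k' k'.+1 N _ _ _ _ _).
have k'N : (k' < N)%N by rewrite -k'S leq_subr.
have {}IH2 : expect N (fun w => eps ^+ 2 * S k'.+1 w) <=
             expect N (fun w => S k'.+1 w * (X k' w - X N w) ^+ 2).
  apply: IH2 => [||w w' ww'|w].
  - by rewrite xk leqnSn.
  - exact: k'N.
  - have e := tB _ _ _ ww'; rewrite /S !indicE.
    suff -> : (w \in strays eps k'.+1 N) = (w' \in strays eps k'.+1 N) by [].
    by apply/idP/idP => /set_mem h; apply/mem_set; [rewrite -e|rewrite e].
  - by rewrite /S indicE; case: (_ \in _).
pose D := strays eps k' N `\` strays eps k'.+1 N.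
have DE w : S k' w = S k'.+1 w + \1_D w.
  have sub : strays eps k'.+1 N w -> strays eps k' N w.
    by case=> n /andP[kn nN] en; exists n => //; rewrite (ltnW kn).
  rewrite /S !indicE /D in_setD.
  case: (boolP (w \in strays eps k'.+1 N)) => [/set_mem/sub/mem_set ->|_].
    by rewrite addr0.
  by rewrite andbT add0r.
apply: (@le_trans _ _ (expect N (fun w => eps ^+ 2 * S k'.+1 w) +
                       expect N (fun w => \1_D w * (X k' w - X N w) ^+ 2))); last first.
  rewrite (eq_expect _ _ (f := fun w => S k' w * _)
    (g := fun w => S k'.+1 w * (X k' w - X N w) ^+ 2 +
                   \1_D w * (X k' w - X N w) ^+ 2)).
    by rewrite expectD lerD2r.
  by move=> w; rewrite DE mulrDl.
rewrite -expectD; apply: expect_le => w; rewrite DE mulrDr lerD2l [leLHS]mulrC.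
rewrite [\1_D w]indicE; case: (boolP (_ \in _)); last by rewrite !mul0r.
rewrite !mul1r => /set_mem[[n /andP[k'n nN] en] nex].
move: k'n; rewrite leq_eqVlt => /orP[/eqP ->|k'n]; first exact: ge_sqr.
by case: nex; exists n => //; rewrite k'n.
Qed.

End ReverseMartingale.

(** * Almost sure convergence of each kernel *)

Section Convergence.
Context {R : realType} {C : combClass} (P : probability (path_space C) R).
Context (HP : is_CMC P).
Local Notation Pr := (Pr P).
Context (x : objects C).
Local Notation X := (kernel_along P x).
Local Notation v := (second_moment P x).

(** Unlike [strays], this event grows with [N], which allows the passage to the
    limit [N -> oo]. *)
Definition oscillates (eps : R) k N : set (path_space C) :=
  [set w | exists n n',
    [/\ (k <= n <= N)%N, (k <= n' <= N)%N & eps *+ 2 <= `|X n w - X n' w|] ].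

Lemma oscillates_determined eps k N : determined_by N (oscillates eps k N).
Proof.
move=> w w' ww'; apply/propext; split => -[n [n' [/andP[kn nN] /andP[kn' nN'] h]]];
  exists n, n'; split; rewrite ?kn ?kn'//; move: h;
  by rewrite (kernel_along_determined P x (ww' _ nN))
             (kernel_along_determined P x (ww' _ nN')).
Qed.

Lemma second_moment_ge0 n : 0 <= v n.
Proof. by apply: expect_ge0 => w; exact: sqr_ge0. Qed.

Lemma second_moment_nonincreasing k N : (tag x <= k <= N)%N -> v N <= v k.
Proof.
move=> kN; rewrite -subr_ge0 -(variance_increment HP kN).
by apply: expect_ge0 => w; exact: sqr_ge0.
Qed.

Lemma second_moment_cauchy d : 0 < d ->
  exists2 k, (tag x <= k)%N & forall N, (k <= N)%N -> v k - v N <= d.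
Proof.
move=> d0; pose u n := v (n + tag x)%N.
have du : nonincreasing_seq u.
  by move=> n n' nn'; apply: second_moment_nonincreasing; rewrite leq_addl leq_add2r.
have lu : has_lbound (range u) by exists 0 => _ [n _ <-]; exact: second_moment_ge0.
have cu := nonincreasing_is_cvgn du lu.
have /cvgrPdist_le/(_ _ d0)[k _ /(_ k (leqnn k)) hk] := cu.
exists (k + tag x)%N; first by rewrite leq_addl.
move=> N kN; have := nonincreasing_cvgn_ge du cu (N - tag x).
have xN : (tag x <= N)%N by rewrite (leq_trans _ kN)// leq_addl.
rewrite {2}/u subnK// => hN; move: hk; rewrite distrC => /(le_trans (ler_norm _)).
by apply: le_trans; rewrite lerB.
Qed.

Lemma Pr_oscillates eps k N : 0 < eps -> (tag x <= k <= N)%N ->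
  eps ^+ 2 * Pr (oscillates eps k N) <= v k - v N.
Proof.
move=> e0 kN; apply: le_trans (maximal_inequality HP e0 kN).
rewrite ler_pM2l ?exprn_gt0//; apply: Pr_le.
- exact: measurable_determined (@oscillates_determined _ _ _).
- apply: (@measurable_determined _ N) => w w' ww'; apply/propext.
  split => -[n /andP[kn nN] h]; exists n; rewrite ?kn//; move: h;
  by rewrite (kernel_along_determined P x (ww' _ nN))
             (kernel_along_determined P x (ww' _ (leqnn N))).
move=> w [n [n' [kn kn' h]]].
have [h1|h1] := leP eps `|X n w - X N w|; first by exists n.
have [h2|h2] := leP eps `|X n' w - X N w|; first by exists n'.
exfalso; move: h; apply/negP; rewrite -ltNge mulr2n.
by apply: le_lt_trans (ler_distD (X N w) _ _) _; rewrite ltrD// distrC.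
Qed.

Lemma oscillates_negligible eps : 0 < eps ->
  P.-negligible (\bigcap_k \bigcup_N oscillates eps k N).
Proof.
move=> e0; set Z := \bigcap_k _.
have mO k N := measurable_determined (@oscillates_determined eps k N).
have mU k : measurable (\bigcup_N oscillates eps k N) by exact: bigcup_measurable.
have mZ : measurable Z by apply: bigcap_measurable => //; exists 0%N.
exists Z; split => //.
apply/eqP; rewrite eq_le measure_ge0 andbT; apply/lee_addgt0Pr => d d0; rewrite add0e.
(* One [k] with small [v k - v N] for all [N] bounds the whole intersection. *)
have [|k xk hk] := @second_moment_cauchy (eps ^+ 2 * d).
  by rewrite mulr_gt0 ?exprn_gt0.
apply: (@le_trans _ _ (P (\bigcup_N oscillates eps k N))).
  by apply: le_measure; rewrite ?inE// => w; apply.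
have nd : nondecreasing_seq (oscillates eps k).
  move=> N N' NN'; apply/subsetPset => w [n [n' [/andP[kn nN] /andP[kn' nN'] h]]].
  by exists n, n'; rewrite kn kn' (leq_trans nN)// (leq_trans nN').
have cP := nondecreasing_cvg_mu (mu := P) (mO k) (mU k) nd.
rewrite -(cvg_lim _ cP)//; apply: lime_le.
  by apply/cvg_ex; eexists; exact: cP.
exists k => // N /= kN.
rewrite -[leLHS]fineK ?fin_num_measure// lee_fin.
have xkN : (tag x <= k <= N)%N by rewrite xk.
have := le_trans (Pr_oscillates e0 xkN) (hk _ kN).
by rewrite ler_pM2l ?exprn_gt0.
Qed.

Lemma kernel_along_cvg : {ae P, forall w, cvgn (X ^~ w)}.
Proof.
have : {ae P, forall w, forall j,
    ~ (\bigcap_k \bigcup_N oscillates j.+1%:R^-1 k N) w}.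
  apply: ae_foralln => j.
  have := @oscillates_negligible (j.+1%:R^-1) _; rewrite invr_gt0 ltr0n => /(_ isT).
  by apply: negligibleS => w /= /contrapT.
apply: filterS => w h; apply/cauchy_cvgP/cauchy_exP => e e0.
pose j := Num.truncn (2 / e).
have jP : j.+1%:R^-1 *+ 2 <= e.
  rewrite -[_ *+ 2]mulr_natl ler_pdivrMr ?ltr0n// mulrC -ler_pdivrMr//.
  by rewrite ltW// truncnS_gt.
have /existsNP[k /not_implyP[_ nk]] := h j.
exists (X k w); exists k => // n /= kn.
rewrite /ball /=; apply: lt_le_trans jP; rewrite ltNge; apply/negP => hn.
by apply: nk; exists n => //; exists k, n; rewrite !leqnn kn.
Qed.

End Convergence.

(** * Limits in the Martin boundary *)

Section Boundary.
Context {R : realType} {C : combClass} (P : probability (path_space C) R).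
Local Notation Pr := (Pr P).
Local Notation X := (kernel_along P).

Definition coordinate (z : martin_product P) (x : pos_objects C) : R := set_val (z x).
Definition boundary_point (b : martin_boundary P) : martin_product P :=
  set_val (set_val b).

Lemma cvg_martin_product (F : set_system (martin_product P)) (FF : Filter F)
    (z : martin_product P) :
  (forall x, coordinate f x @[f --> F] --> coordinate z x) -> F --> z.
Proof.
by move=> h; apply: cvg_prod_topology => x; apply: cvg_set_type; exact: h.
Qed.

(** The total probability of [Y_m] given that [y] is visited; this identity
    separates limits of long paths from objects. *)
Lemma martin_kernel_sum (HP : is_CMC P) m (y : objects C) : (m <= tag y)%N ->
  \sum_(c : C m) Pr (visits (Tagged (obj C) c)) *
                 martin_kernel P (Tagged (obj C) c) y = 1.
Proof.
move=> my; have py := visits_gt0 HP y.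
apply: (mulIf (lt0r_neq0 py)); rewrite mul1r mulr_suml.
rewrite [RHS](@Pr_partition _ _ P _
  (fun c : C m => visits (Tagged (obj C) c)) (visits y)).
- by apply: eq_bigr => c _; rewrite -(martin_kernelE HP)// setIC.
- exact: measurable_visits.
- by move=> c; exact: measurable_visits.
- by move=> w _; exists (w m).
- by move=> c c' w; rewrite /visits /= => ->.
Qed.

Lemma boundary_limit (HP : is_CMC P) (w : paths C) :
  (forall x : pos_objects C, cvgn (X (pos_object x) ^~ w)) ->
  exists b : martin_boundary P,
    in_doob_martin P (Tagged (obj C) (Y n w)) @[n --> \oo] --> in_compactification b /\
    forall x, X (pos_object x) n w @[n --> \oo] --> coordinate (boundary_point b) x.
Proof.
move=> cw; pose l x := limn (X (pos_object x) ^~ w).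
have lP x : kernel_range P (pos_object x) (l x).
  have K n := martin_kernel_range P (pos_object x) (Tagged (obj C) (Y n w)).
  rewrite /kernel_range /= in_itv /=; apply/andP; split.
    apply: limr_ge; first exact: cw.
    by near=> n; have := K n; rewrite /kernel_range /= in_itv => /andP[].
  apply: limr_le; first exact: cw.
  by near=> n; have := K n; rewrite /kernel_range /= in_itv => /andP[].
pose z : martin_product P := fun x =>
  exist (fun k => k \in kernel_range P (pos_object x)) (l x) (mem_set (lP x)).
have mz : martin_map P (Tagged (obj C) (Y n w)) @[n --> \oo] --> z.
  by apply: cvg_martin_product => x; exact: cw.
have zc : closure (range (martin_map P)) z.
  move=> B /mz[N _ NB]; exists (martin_map P (Tagged (obj C) (Y N w))); split.
    by exists (Tagged (obj C) (Y N w)).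
  by apply: NB => /=.
pose z' : doob_martin P := exist (fun z => z \in _) z (mem_set zc).
have nz' : (~` range (in_doob_martin P)) z'.
  (* An object [y] has kernel 0 at all objects of size [(tag y).+1], whereas the
     weighted sum of the coordinates of [z] over that size is 1. *)
  move=> [y _ /(congr1 set_val) yz].
  pose m := (tag y).+1.
  have l0 (c : C m) : l (Tagged (fun m => obj C m.+1) c) = 0.
    have <- : martin_kernel P (Tagged (obj C) c) y = l _ :=
      congr1 (coordinate ^~ (Tagged (fun m => obj C m.+1) c)) yz.
    by rewrite /martin_kernel /= ltnn.
  have : \sum_(c : C m) Pr (visits (Tagged (obj C) c)) *
                        X (Tagged (obj C) c) n w @[n --> \oo]
      --> \sum_(c : C m) Pr (visits (Tagged (obj C) c)) * 0.
    apply: cvg_big => [|c _]; first exact: add_continuous.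
    apply: cvgMl_tmp; rewrite -(l0 c).
    exact: (cw (Tagged (fun m => obj C m.+1) c)).
  rewrite big1; last by move=> c _; rewrite mulr0.
  move=> h0.
  have h1 : \sum_(c : C m) Pr (visits (Tagged (obj C) c)) *
                           X (Tagged (obj C) c) n w @[n --> \oo] --> (1 : R).
    apply: cvg_near_cst.
    by exists m => // n /= mn; rewrite /kernel_along (martin_kernel_sum HP).
  suff : (0 : R) = 1 by move/eqP; rewrite eq_sym oner_eq0.
  exact: (cvg_unique _ h0 h1).
exists (exist (fun z => z \in _) z' (mem_set nz')); split.
  by apply: cvg_set_type; exact: mz.
by move=> x; exact: cw.
Unshelve. all: by end_near. Qed.

(** * Measurability of boundary-valued maps *)

(** A box in the product topology that constrains the first [r] coordinates, in
    the enumeration of [pos_objects C] given by [pickle]. *)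
Definition in_box (r : nat) (d : R) (f g : pos_objects C -> R) :=
  forall x : pos_objects C, (pickle x < r)%N -> `|f x - g x| < d.

Definition kernel_profile (y : objects C) : pos_objects C -> R :=
  fun x => martin_kernel P (pos_object x) y.

(** Otherwise, points chosen in the boxes but outside [U] would converge to [z]
    coordinatewise.  The side is 2/(r + 1) so that the box contains every box of
    side 1/(r + 1) whose centre is within 1/(r + 1) of [z]. *)
Lemma open_box (U : set (martin_product P)) z : open U -> U z ->
  exists r, forall z',
    in_box r (r.+1%:R^-1 *+ 2) (coordinate z') (coordinate z) -> U z'.
Proof.
move=> oU Uz; apply: contrapT => /forallNP nr.
have /choice[s sP] : forall r, exists z',
    in_box r (r.+1%:R^-1 *+ 2) (coordinate z') (coordinate z) /\ ~ U z'.
  move=> r; have /existsNP[z' /not_implyP[h1 h2]] := nr r.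
  by exists z'.
suff sz : s r @[r --> \oo] --> z.
  have [N _ /(_ N (leqnn N))] := sz U (open_nbhs_nbhs (conj oU Uz)).
  by have [] := sP N.
apply: cvg_martin_product => x.
suff h : coordinate (s r) x @[r --> \oo] --> coordinate z x by exact: h.
apply/cvgrPdist_lt => e e0; near=> r.
have [sx _] := sP r; rewrite distrC; apply: (lt_trans (sx x _)).
  by near: r; exists (pickle x).+1.
rewrite -[_ *+ 2]mulr_natl ltr_pdivrMr// mulrC -ltr_pdivrMr//.
near: r; exists (Num.truncn (2 / e)) => // r /= h.
by apply: lt_le_trans (truncnS_gt _) _; rewrite ler_nat.
Unshelve. all: by end_near. Qed.

(** An open set is the union of the boxes centred at objects that it contains,
    as far as limits of objects are concerned; there are countably many such
    boxes, each a countable intersection of conditions on coordinates. *)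
Lemma boundary_rv_coordinates (Z : path_space C -> martin_boundary P) :
  (forall x, measurable_fun setT (fun w => coordinate (boundary_point (Z w)) x)) ->
  (forall w, exists y : nat -> objects C, forall x,
     kernel_profile (y n) x @[n --> \oo] --> coordinate (boundary_point (Z w)) x) ->
  boundary_rv Z.
Proof.
move=> mZ dZ B hB; apply: (hB [set B | measurable (Z @^-1` B)]); split.
  split => /= [|A mA|F mF].
  - by rewrite preimage_set0.
  - by rewrite setTD; exact: (measurableC mA).
  - by rewrite preimage_bigcup; exact: bigcupT_measurable.
move=> U [U1 [U2 oU2 <-] <-] /=.
pose c w := coordinate (boundary_point (Z w)).
pose V r y : set (path_space C) :=
  [set w | in_box r r.+1%:R^-1 (c w) (kernel_profile y)].
pose inside r y := forall z : martin_product P,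
  in_box r r.+1%:R^-1 (coordinate z) (kernel_profile y) -> U2 z.
rewrite (_ : _ @^-1` _ = \bigcup_r \bigcup_(y : objects C)
                           (if `[< inside r y >] then V r y else set0)).
  apply: bigcupT_measurable => r; apply: countable_bigcupT_measurable => [|y].
    exact: (@countableP {n : nat & C n}).
  case: ifP => // _.
  rewrite (_ : V r y = \bigcap_i
    (if unpickle i is Some x then if (pickle x < r)%N then
      [set w | `|c w x - kernel_profile y x| < r.+1%:R^-1]
     else setT else setT)).
    apply: bigcapT_measurable => i; case: (unpickle i) => // x; case: ifP => // _.
    have := mZ x measurableT (ball (kernel_profile y x) r.+1%:R^-1) _.
    rewrite {1}ball_itv => /(_ (measurable_itv _)).
    rewrite setTI; congr measurable.
    by apply/seteqP; split => w; rewrite /ball /= distrC.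
  apply/seteqP; split => w.
    by move=> h i _; case: (unpickle i) => // x; case: ifP => // ; exact: h.
  by move=> h x xr; have := h (pickle x) I; rewrite pickleK xr.
apply/seteqP; split => [w /= Uw|w [r _ [y _]]]; last first.
  by case: ifPn => // /asboolP gy; exact: gy.
have [r hr] := open_box oU2 Uw; have [y hy] := dZ w.
have : \forall n \near \oo, forall i : 'I_r, forall x : pos_objects C,
    pickle x = i -> `|c w x - kernel_profile (y n) x| < r.+1%:R^-1.
  apply: filter_forall => i.
  case e : (unpickle (i : nat) : option (pos_objects C)) => [x|]; last first.
    by apply: nearW => n x xi; move: e; rewrite -xi pickleK.
  have : \forall n \near \oo, `|c w x - kernel_profile (y n) x| < r.+1%:R^-1.
    by apply: (cvgrPdist_lt _ _).1; [exact: hy|rewrite invr_gt0].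
  by apply: filterS => n hn x' xi; move: e; rewrite -xi pickleK => -[->].
case=> N _ /(_ N (leqnn N)) hN; exists r => //; exists (y N) => //.
have Vw : V r (y N) w by move=> x xr; exact: (hN (Ordinal xr)).
rewrite asboolT// => z hz; apply: hr => x xr; rewrite mulr2n.
apply: le_lt_trans (ler_distD (kernel_profile (y N) x) _ _) _.
by rewrite ltrD ?hz// distrC; exact: Vw.
Qed.

(** * Convergence of the chain to the boundary *)

Lemma measurable_kernel_along x n : measurable_fun setT (X x n : path_space C -> R).
Proof.
move=> _ B _; rewrite setTI.
exact: (@measurable_coord _ n [set c | B (martin_kernel P x (Tagged (obj C) c))]).
Qed.

Lemma martin_kernel_cvg_ae (HP : is_CMC P) :
  {ae P, forall w, forall x : pos_objects C, cvgn (X (pos_object x) ^~ w)}.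
Proof.
have : {ae P, forall w, forall i,
    if (unpickle i : option (pos_objects C)) is Some x
    then cvgn (X (pos_object x) ^~ w) else True}.
  apply: ae_foralln => i; case: (unpickle i) => [x|]; last exact: aeW.
  exact: kernel_along_cvg.
apply: negligibleS => w /= nw h; apply: nw => x.
by have := h (pickle x); rewrite pickleK.
Qed.

End Boundary.

End MartinLimit.

Theorem theorem2 (R : realType) (C : combClass)
    (P : probability (path_space C) R) (HP : is_CMC P) :
  exists Yoo : path_space C -> martin_boundary P,
    boundary_rv Yoo /\
    {ae P, forall w,
      in_doob_martin P (Tagged (obj C) (Y n w)) @[n --> \oo]
        --> in_compactification (Yoo w)}.
Proof.
have [N [mN PN hN]] := martin_kernel_cvg_ae HP.
have [w0 w0N] : exists w, ~ N w.
  apply: contrapT => /forallNP h; have : P setT = 0%E.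
    rewrite -PN; congr (P _); apply/seteqP; split => // w _.
    by apply: contrapT; exact: h.
  by rewrite probability_setT => /eqP; rewrite onee_eq0.
(* Paths in the null set are redirected to a fixed path along which the chain
   converges, so that the limit is defined everywhere. *)
pose rho w := if w \in ~` N then w else w0.
have good w (x : pos_objects C) : cvgn (kernel_along P (pos_object x) ^~ (rho w)).
  suff nN : ~ N (rho w).
    by apply: contrapT => nc; apply: nN; apply: hN => /(_ x).
  by rewrite /rho; case: ifPn => // /set_mem.
have /choice[Yoo YooP] := fun w => @boundary_limit R C P HP (rho w) (good w).
exists Yoo; split; last first.
  exists N; split => // w /= nw; apply: contrapT => nN; apply: nw.
  by have [] := YooP w; rewrite /rho mem_set.
apply: boundary_rv_coordinates => [x|w]; last first.
  exists (fun n => Tagged (obj C) (Y n (rho w))) => x.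
  by have [_ h] := YooP w; exact: h.
apply: (@measurable_fun_cvg _ _ _ _
  (fun n w => kernel_along P (pos_object x) n (rho w))); last first.
  by move=> w _; have [_ h] := YooP w; exact: h.
move=> n; rewrite (_ : (fun w => _) = fun w =>
    if w \in ~` N then kernel_along P (pos_object x) n w
    else kernel_along P (pos_object x) n w0).
  apply: measurable_fun_ifT; [|exact: measurable_kernel_along|exact: measurable_cst].
  apply: (measurable_fun_bool true); rewrite setTI (_ : _ @^-1` _ = ~` N).
    exact: measurableC.
  by apply/seteqP; split => w /=; [move/set_mem|move/mem_set].
by apply/funext => w; rewrite /rho; case: ifP.
Qed.
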